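(* Fix $q\in[1,\infty)$ and assume that the measures $\nu^*_s=\mathrm{Law}(f^*(\boldsymbol X,S)\mid S=s)$, $s\in[K]$, are non-atomic with finite $q$-th moments. Then for every $\alpha\in[0,1]$ a solution $f^*_{\alpha,q}$ of $$\min_{f:\mathbb R^p\times[K]\to\mathbb R}\big\{\mathcal R_q(f)\;:\;\mathcal U_q(f)\le\alpha\,\mathcal U_q(f^* )\big\}$$ can be written, for all $(\boldsymbol x,s)\in\mathbb R^p\times[K]$, as $$f^*_{\alpha,q}(\boldsymbol x,s)=\alpha^{1/q}f^*(\boldsymbol x,s)+(1-\alpha^{1/q})\cdot\arg\min_{y\in\mathbb R}\Big\{\sum_{s'=1}^Kw_{s'}\big|F^{-1}_{\nu^*_{s'}}\circ F_{\nu^*_s}\circ f^*(\boldsymbol x,s)-y\big|^q\Big\},$$ and it holds that $\mathcal R_q(f^*_{\alpha,q})=(1-\alpha^{1/q})^q\,\mathcal U_q(f^* )$ and $\mathcal U_q(f^*_{\alpha,q})=\alpha\,\mathcal U_q(f^* )$.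
   Context: $(\boldsymbol X,S)$ random in $\mathbb R^p\times[K]$ with $\mathbb P(S=s)>0$; $f^*$ measurable; $\boldsymbol w\in\Delta^{K-1}$. $\mathcal R_q(f)=\sum_sw_s\mathbb E[|f(\boldsymbol X,S)-f^*(\boldsymbol X,S)|^q\mid S=s]$ and $\mathcal U_q(f)=\min_{\nu\in\mathcal P_q(\mathbb R)}\sum_sw_s\mathsf W_q^q(\mathrm{Law}(f(\boldsymbol X,S)\mid S=s),\nu)$, where $\mathcal P_q(\mathbb R)$ is the set of probability measures with finite $q$-th moment and $\mathsf W_q$ the Wasserstein-$q$ distance. $F_\mu$ is the CDF and $F^{-1}_\mu(u)=\inf\{x:F_\mu(x)\ge u\}$. For $q=1$ the $\arg\min$ may not be a singleton; the formula is to be read with a suitable choice of minimizer. *)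

(* Defs.v *)
From HB Require Import structures.
From mathcomp Require Import all_boot all_order all_algebra.
From mathcomp Require Import all_classical all_reals all_analysis.
Set Implicit Arguments. Unset Strict Implicit. Unset Printing Implicit Defensive.
Import Order.TTheory GRing.Theory Num.Theory.
Import numFieldNormedType.Exports.
Local Open Scope classical_set_scope.
Local Open Scope ring_scope.

Definition borel_rV (R : realType) (p : nat) : set (set 'rV[R]_p) :=
  <<s [set U : set 'rV[R]_p | open U] >>.

Definition measurable_rV d (T : measurableType d) (R : realType) (p : nat)
  (X : T -> 'rV[R]_p) : Prop :=
  forall U, borel_rV U -> measurable (X @^-1` U).

(** Borel measurability of f : R^p x [K] -> R ([K] carries the discrete
    sigma-algebra, so this amounts to measurability of each section). *)
Definition measurable_feat (R : realType) (p K : nat)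
  (f : 'rV[R]_p -> 'I_K -> R) : Prop :=
  forall (s : 'I_K) (B : set R), measurable B ->
    borel_rV ((fun x => f x s) @^-1` B).

Definition evS d (T : measurableType d) (K : nat) (S : T -> 'I_K) (s : 'I_K)
  : set T := S @^-1` [set s].

Definition condlaw d (T : measurableType d) (R : realType) (P : probability T R)
  (K : nat) (S : T -> 'I_K) (Y : T -> R) (s : 'I_K) : set R -> \bar R :=
  fun A => (P (Y @^-1` A `&` evS S s) * ((fine (P (evS S s)))^-1)%:E)%E.

Definition condexp d (T : measurableType d) (R : realType) (P : probability T R)
  (K : nat) (S : T -> 'I_K) (Y : T -> \bar R) (s : 'I_K) : \bar R :=
  ((\int[P]_(om in evS S s) Y om) * ((fine (P (evS S s)))^-1)%:E)%E.

Definition absq (R : realType) (q x : R) : R := `|x| `^ q.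

Definition coupling (R : realType) (mu nu : set R -> \bar R)
  (pi : probability (R * R)%type R) : Prop :=
  (forall A : set R, measurable A -> pi (A `*` setT) = mu A) /\
  (forall B : set R, measurable B -> pi (setT `*` B) = nu B).

Definition Wqq (R : realType) (q : R) (mu nu : set R -> \bar R) : \bar R :=
  ereal_inf [set (\int[pi]_z (absq q (z.1 - z.2))%:E)%E
            | pi in [set pi | coupling mu nu pi]].

Definition finite_moment (R : realType) (q : R) (nu : probability R R) : Prop :=
  (\int[nu]_y (absq q y)%:E < +oo)%E.

Definition pred_rv d (T : measurableType d) (R : realType) (p K : nat)
  (X : T -> 'rV[R]_p) (S : T -> 'I_K) (f : 'rV[R]_p -> 'I_K -> R) : T -> R :=
  fun om => f (X om) (S om).

Definition Rq d (T : measurableType d) (R : realType) (P : probability T R)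
  (p K : nat) (X : T -> 'rV[R]_p) (S : T -> 'I_K) (w : 'I_K -> R) (q : R)
  (fstar f : 'rV[R]_p -> 'I_K -> R) : \bar R :=
  (\sum_(s < K) (w s)%:E *
     condexp P S (fun om => (absq q (pred_rv X S f om - pred_rv X S fstar om))%:E) s)%E.

(** Unfairness U_q(f) = min_{nu in P_q} sum_s w_s W_q^q(Law(f(X,S)|S=s), nu)
    (written as an infimum; the minimum is attained). *)
Definition Uq d (T : measurableType d) (R : realType) (P : probability T R)
  (p K : nat) (X : T -> 'rV[R]_p) (S : T -> 'I_K) (w : 'I_K -> R) (q : R)
  (f : 'rV[R]_p -> 'I_K -> R) : \bar R :=
  ereal_inf [set (\sum_(s < K) (w s)%:E * Wqq q (condlaw P S (pred_rv X S f) s) nu)%E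
            | nu in [set nu : probability R R | finite_moment q nu]].

Definition cdf_of (R : realType) (mu : set R -> \bar R) (x : R) : R :=
  fine (mu [set` `]-oo, x]]).

(** Quantile F_mu^{-1}(u) = inf {x : F_mu(x) >= u} (real infimum; the value is
    a library default when the set is empty or unbounded below). *)
Definition quantile_of (R : realType) (mu : set R -> \bar R) (u : R) : R :=
  inf [set x : R | u <= cdf_of mu x].

(* Main.v *)
Require Import Defs.
From HB Require Import structures.
From mathcomp Require Import all_boot all_order all_algebra.
From mathcomp Require Import all_classical all_reals all_analysis.
From mathcomp Require Import measurable_realfun ring lra.
Set Implicit Arguments. Unset Strict Implicit. Unset Printing Implicit Defensive.
Import Order.TTheory GRing.Theory Num.Theory.
Import numFieldNormedType.Exports.
Local Open Scope classical_set_scope.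
Local Open Scope ring_scope.

(**
Under a common uniform variable u, the laws nu*_s are represented by their quantile
functions Q_s, and the least pointwise minimizer M(u) of
y |-> sum_s w_s |Q_s(u) - y|^q is nondecreasing in u.  Put
C = sum_s w_s \int_0^1 |Q_s - M|^q.

Among all couplings, the comonotone one minimizes E|X - Y|^q: writing
(x - y)_+^q = \int_y^x q (u - y)^(q-1) du and using Tonelli, the cost becomes an
integral of P(X >= u, Y in D) over u and over lower sets D, and these probabilities
are minimal when {X < u} and {Y in D} are nested.  Hence W_q^q(mu, nu) and
E|f - f*|^q both dominate integrals of differences of quantile functions.  No gluing
of couplings is needed: applying
|x + y|^q <= t^(1-q) |x|^q + (1-t)^(1-q) |y|^q
to quantile functions gives C <= t^(1-q) R_q(f) + (1-t)^(1-q) U_q(f) for every f and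
0 < t < 1.  Conversely, since F_s(f* ) is uniform given S = s, the pair
(f*, M(F_s(f* ))) is a coupling of nu*_s with the law of M(u), so U_q(f* ) = C and
the interpolation g has R_q(g) = (1-a)^q C and U_q(g) <= a^q C.  Optimality of g and
equality for U_q(g) follow by taking t = 1 - a (t -> 1 when a = 0).
*)

(** * Continuity, convexity and exchange inequalities for the power cost *)

Lemma continuous_absq {R : realType} (q : R) : 0 < q -> continuous (absq q).
Proof.
move=> q0 x; have [->|x0] := eqVneq x 0.
  rewrite /continuous_at {2}/absq normr0 powR0 ?gt_eqF//.
  apply/cvgrPdist_le => e e0; near=> z.
  rewrite sub0r normrN ger0_norm ?powR_ge0//.
  have -> : e = (e `^ q^-1) `^ q by rewrite -powRrM mulVf ?gt_eqF// powRr1// ltW.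
  apply: ge0_ler_powR; rewrite ?nnegrE ?powR_ge0 ?(ltW q0)//.
  by near: z; exact: (@nbhs0_le R R^o _ (powR_gt0 q^-1 e0)).
apply: (@continuous_comp _ _ _ (fun z : R => `|z|) (@powR R ^~ q)).
  exact: norm_continuous.
apply/differentiable_continuous/derivable1_diffP.
by apply: derivable_powR; rewrite in_itv/= andbT normr_gt0.
Unshelve. all: by end_near. Qed.

Section absq_theory.
Context {R : realType} {q : R}.
Hypothesis q1 : 1 <= q.
Implicit Types x y z t : R.

Let q0 : 0 < q. Proof. exact: lt_le_trans ltr01 q1. Qed.

Lemma absq_ge0 x : 0 <= absq q x.
Proof. exact: powR_ge0. Qed.

Lemma absq0 : absq q 0 = 0.
Proof. by rewrite /absq normr0 powR0// gt_eqF. Qed.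

Lemma absqN x : absq q (- x) = absq q x.
Proof. by rewrite /absq normrN. Qed.

Lemma absqC x y : absq q (x - y) = absq q (y - x).
Proof. by rewrite -absqN opprB. Qed.

Lemma absqM x y : 0 <= x -> absq q (x * y) = x `^ q * absq q y.
Proof. by move=> x0; rewrite /absq normrM powRM// ger0_norm. Qed.

Lemma absq_convex t x y : 0 <= t <= 1 ->
  absq q (t * x + (1 - t) * y) <= t * absq q x + (1 - t) * absq q y.
Proof.
move=> /andP[t0 t1].
have t1' : 0 <= 1 - t by rewrite subr_ge0.
apply: (@le_trans _ _ ((t * `|x| + (1 - t) * `|y|) `^ q)).
  apply: ge0_ler_powR; rewrite ?nnegrE ?(ltW q0)//.
    by rewrite addr_ge0// mulr_ge0.
  by rewrite (le_trans (ler_normD _ _))// !normrM !(ger0_norm t0, ger0_norm t1').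
have := @convex_powR R q q1 (Itv01 t0 t1) `|x| `|y|.
rewrite !inE/= !in_itv/= !normr_ge0 => /(_ isT isT).
by rewrite !convRE /=.
Qed.

(* Convexity applied to [x + y = t (x / t) + (1 - t) (y / (1 - t))]; it replaces
   Minkowski's inequality, being linear in the costs. *)
Lemma absq_split t x y : 0 < t < 1 ->
  absq q (x + y) <= t `^ (1 - q) * absq q x + (1 - t) `^ (1 - q) * absq q y.
Proof.
move=> /andP[t0 t1].
have t1' : 0 < 1 - t by rewrite subr_gt0.
have split0 s z : 0 < s -> s * absq q (s^-1 * z) = s `^ (1 - q) * absq q z.
  move=> s0; rewrite absqM ?invr_ge0 ?ltW// mulrA; congr (_ * _).
  rewrite powRB ?powRr1 ?(ltW s0)//; last by rewrite (gt_eqF s0) implybT.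
  congr (_ * _); rewrite -(powR_inv1 (ltW s0)) -powRrM mulN1r.
  by rewrite powRN.
rewrite -!split0//.
have := @absq_convex t (t^-1 * x) ((1 - t)^-1 * y).
rewrite !mulVKf ?gt_eqF//; apply.
by rewrite !ltW.
Qed.

(** The differences [x - y] and [x' - y'] lie between [x - y'] and [x' - y] and have the same sum,
    so they are convex combinations of these two with swapped weights [t] and [1 - t]. Adding the
    two convexity inequalities gives the claim. *)
Lemma absq_exchange x x' y y' : x <= x' -> y <= y' ->
  absq q (x - y) + absq q (x' - y') <= absq q (x - y') + absq q (x' - y).
Proof.
move=> xx' yy'.
have [D0|D0] := eqVneq ((x' - x) + (y' - y)) 0.
  have ex : x' = x by lra.
  have ey : y' = y by lra.
  by rewrite ex ey.
have Dgt0 : 0 < (x' - x) + (y' - y).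
  by rewrite lt_neqAle eq_sym D0 /= addr_ge0// subr_ge0.
set D := (x' - x) + (y' - y) in D0 Dgt0.
pose t := (x' - x) / D.
have t01 : 0 <= t <= 1.
  by rewrite divr_ge0 ?subr_ge0 ?(ltW Dgt0)//= ler_pdivrMr// mul1r /D lerDl subr_ge0.
have e1 : x - y = t * (x - y') + (1 - t) * (x' - y).
  by rewrite /t /D; field.
have e2 : x' - y' = t * (x' - y) + (1 - t) * (x - y').
  by rewrite /t /D; field.
have := absq_convex (x - y') (x' - y) t01.
have := absq_convex (x' - y) (x - y') t01.
rewrite -e1 -e2; nra.
Qed.

Lemma measurable_absq : measurable_fun [set: R] (absq q).
Proof. exact: (measurableT_comp (measurable_powR q)). Qed.

End absq_theory.

(** * Weighted power means *)

Section frechet_mean.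
Context {R : realType} (q : R) {K : nat} (w : 'I_K -> R).
Hypothesis q1 : 1 <= q.
Hypothesis w0 : forall s, 0 <= w s.
Hypothesis w1 : \sum_(s < K) w s = 1.
Implicit Types x : 'I_K -> R.

Definition dispersion x (y : R) : R := \sum_(s < K) w s * absq q (x s - y).

(* Taking the least minimizer makes the selection monotone in [x]. *)
Definition least_mean x : R :=
  inf [set y | forall z, dispersion x y <= dispersion x z].

Let q0 : 0 < q. Proof. exact: lt_le_trans ltr01 q1. Qed.

Lemma dispersion_ge0 x y : 0 <= dispersion x y.
Proof. by apply: sumr_ge0 => s _; rewrite mulr_ge0// absq_ge0. Qed.

Lemma continuous_dispersion x : continuous (dispersion x).
Proof.
rewrite /dispersion; apply: continuous_big => [|s _ y]; first exact: add_continuous.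
apply: cvgM; first exact: cvg_cst.
apply: (@continuous_comp _ _ _ (fun y : R => x s - y) (absq q)).
  by apply: cvgB; [exact: cvg_cst|exact: cvg_id].
by apply: continuous_absq.
Qed.

Lemma exists_weight_gt0 : exists s, 0 < w s.
Proof.
apply/not_existsP => wN; have : \sum_(s < K) w s = 0.
  apply: big1 => s _; apply/eqP; rewrite eq_le w0 andbT leNgt.
  by apply/negP/wN.
by rewrite w1; apply/eqP; rewrite oner_eq0.
Qed.

(** One group of positive weight already confines [y]: its term bounds [|x s - y|^q], and
    [|r| <= 1 + |r|^q] since [q >= 1]. This reduces minimization to a compact interval. *)
Lemma dispersion_coercive x : exists2 L, 0 <= L &
  forall y, dispersion x y <= dispersion x 0 -> `|y| <= L.
Proof.
have [s ws] := exists_weight_gt0.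
pose C := dispersion x 0 / w s.
exists (`|x s| + (1 + C)) => [|y yx0].
  by rewrite !addr_ge0// divr_ge0// dispersion_ge0.
have xsy : absq q (x s - y) <= C.
  rewrite /C ler_pdivlMr// mulrC; apply: le_trans yx0.
  rewrite /dispersion (bigD1 s)//= lerDl sumr_ge0// => i _.
  by rewrite mulr_ge0// absq_ge0.
have : `|x s - y| <= 1 + C.
  have [xs1|xs1] := leP `|x s - y| 1.
    by rewrite (le_trans xs1)// lerDl (le_trans _ xsy)// absq_ge0.
  apply: (@le_trans _ _ (absq q (x s - y))); last by rewrite (le_trans xsy)// lerDr.
  by rewrite le1r_powR// ltW.
move=> h; rewrite -[y](subrK (x s)) (le_trans (ler_normD _ _))// addrC lerD2l.
by rewrite distrC.
Qed.

Lemma least_mean_subproof x :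
  has_inf [set y | forall z, dispersion x y <= dispersion x z].
Proof.
have [L L0 xL] := dispersion_coercive x.
split; last first.
  exists (- L) => y /= /(_ 0) /xL; rewrite ler_norml => /andP[]//.
have [||c cL xc] := @EVT_min R (dispersion x) (- L) L.
- by rewrite (le_trans _ L0)// oppr_le0.
- by apply: continuous_subspaceT; exact: continuous_dispersion.
exists c => z /=.
have [zL|zL] := boolP (z \in `[(- L), L]); first exact: xc.
apply: (@le_trans _ _ (dispersion x 0)).
  by apply: xc; rewrite in_itv/= oppr_le0 L0.
rewrite leNgt; apply: contra zL => /ltW/xL.
by rewrite ler_norml in_itv.
Qed.

(** The infimum of the minimizers is itself one: were the dispersion larger there, continuity would
    keep it larger nearby, where a minimizer [b] exists. *)
Lemma least_meanP x y : dispersion x (least_mean x) <= dispersion x y.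
Proof.
have [[c cmin] _] := least_mean_subproof x.
apply: (@le_trans _ _ (dispersion x c)); last exact: cmin.
rewrite leNgt; apply/negP => clt.
have := @continuous_dispersion x (least_mean x).
move=> /cvgrPdist_lt.
move=> /(_ (dispersion x (least_mean x) - dispersion x c)).
rewrite subr_gt0 => /(_ clt) [e/= e0 He].
have [b bmin blt] := inf_adherent e0 (least_mean_subproof x).
have lb : least_mean x <= b.
  by apply: ge_inf => //; exact: (least_mean_subproof x).2.
have := He b; rewrite /= distrC ger0_norm ?subr_ge0// ltrBlDl => /(_ blt).
move=> /(le_lt_trans (ler_norm _)); rewrite ltrD2l ltrN2 => /lt_le_trans.
by move=> /(_ _ (bmin c)); rewrite ltxx.
Qed.

Lemma dispersion_exchange x x' y y' : (forall s, x s <= x' s) -> y <= y' ->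
  dispersion x y + dispersion x' y' <= dispersion x y' + dispersion x' y.
Proof.
move=> xx' yy'; rewrite /dispersion -[leLHS]big_split -[leRHS]big_split/=.
apply: ler_sum => s _; rewrite -[leLHS]mulrDr -[leRHS]mulrDr.
by rewrite ler_wpM2l//; exact: absq_exchange.
Qed.

(** If the means were in the wrong order, the exchange inequality would make [least_mean x'] a
    minimizer for [x] lying below the least one. *)
Lemma least_mean_homo x x' : (forall s, x s <= x' s) ->
  least_mean x <= least_mean x'.
Proof.
move=> xx'; rewrite leNgt; apply/negP => ltm.
have lemin : forall z, dispersion x (least_mean x') <= dispersion x z.
  move=> z; apply: le_trans (least_meanP x z).
  rewrite -(lerD2r (dispersion x' (least_mean x))).
  apply: (le_trans (dispersion_exchange xx' (ltW ltm))).
  rewrite lerD2l.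
  exact: least_meanP.
have : least_mean x <= least_mean x'.
  by apply: ge_inf => //; exact: (least_mean_subproof x).2.
by rewrite leNgt ltm.
Qed.

End frechet_mean.

(** * Optimality of comonotone couplings *)

Section comonotone.
Context {R : realType} {d1 d2} {T1 : measurableType d1} {T2 : measurableType d2}.
Variables (P1 : probability T1 R) (P2 : probability T2 R).
Local Open Scope ereal_scope.

(** The mass of [B] outside [A] is always at least [0] and at least the mass of [B] minus that of
    [A]. For sets nested up to a null set, one of these bounds is attained. *)
Lemma probability_setD_nested_le (A1 B1 : set T1) (A2 B2 E : set T2) :
  measurable A1 -> measurable B1 ->
  measurable A2 -> measurable B2 -> measurable E ->
  P1 A1 = P2 A2 -> P1 B1 = P2 B2 -> P2 (~` E) = 0 ->
  (A2 `&` E `<=` B2 \/ B2 `&` E `<=` A2) ->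
  P2 (B2 `\` A2) <= P1 (B1 `\` A1).
Proof.
move=> mA1 mB1 mA2 mB2 mE PA PB E0 AB.
have nullE C : measurable C -> C `&` E = set0 -> P2 C = 0.
  move=> mC CE; apply/eqP; rewrite eq_le measure_ge0 andbT -E0.
  apply: le_measure; rewrite ?inE//; first exact: measurableC.
  by apply/disjoints_subset.
have [AEB|BEA] := AB; last first.
  rewrite (nullE (B2 `\` A2))//; first exact: measurableD.
  by rewrite -subset0 => x [[Bx Ax] Ex]; exact/Ax/BEA.
have A2B2 : P2 A2 = P2 (A2 `&` B2).
  have -> : P2 A2 = P2 (A2 `\` B2) + P2 (A2 `&` B2) by exact: measureDI.
  rewrite (nullE (A2 `\` B2)) ?add0e//; first exact: measurableD.
  by rewrite -subset0 => x [[Ax Bx] Ex]; exact/Bx/AEB.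
have : P1 A1 + P2 (B2 `\` A2) <= P1 A1 + P1 (B1 `\` A1).
  have <- : P2 B2 = P1 A1 + P2 (B2 `\` A2).
    by rewrite PA A2B2 setIC addeC; exact: measureDI.
  rewrite -PB.
  apply: le_trans (measureU2 _ _ _); rewrite //; last exact: measurableD.
  apply: le_measure; rewrite ?inE//.
    by apply: measurableU => //; exact: measurableD.
  by move=> x Bx; have [Ax|Ax] := pselect (A1 x); [left|right].
by rewrite leeD2lE// fin_num_measure.
Qed.

End comonotone.

(** * Layer-cake formula and integral kernel of the cost *)

Section layer_cake.
Local Open Scope ereal_scope.
Context {R : realType} {d} {T : measurableType d} (P : probability T R).

Lemma ge0_layer_cake (g : T -> R) : measurable_fun [set: T] g ->
  (forall t, 0 <= g t)%R ->
  \int[P]_t (g t)%:E =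
  \int[lebesgue_measure]_(r in `[0%R, +oo[) P [set t | (r < g t)%R].
Proof.
move=> mg g0.
pose G : {RV P >-> R} := HB.pack g (isMeasurableFun.Build _ _ _ _ g mg).
have := @ge0_expectation_ccdf _ _ _ P G g0.
rewrite unlock => ->; apply: eq_integral => r _.
by rewrite /ccdf /distribution /pushforward; congr (P _); apply/seteqP; split => t /=;
  rewrite in_itv/= andbT.
Qed.

Lemma measurable_survival (g : T -> R) : measurable_fun [set: T] g ->
  measurable_fun [set: R] (fun r => P [set t | (r < g t)%R]).
Proof.
move=> mg.
pose G : {RV P >-> R} := HB.pack g (isMeasurableFun.Build _ _ _ _ g mg).
apply: eq_measurable_fun (ccdf_measurable G) => r _.
by rewrite /ccdf /distribution /pushforward; congr (P _); apply/seteqP; split => t /=;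
  rewrite in_itv/= andbT.
Qed.

End layer_cake.

Section hinge.
Context {R : realType} (q : R).
Hypothesis q1 : 1 <= q.
Implicit Types x y u : R.

Let q0 : 0 < q. Proof. exact: lt_le_trans ltr01 q1. Qed.

(* The kernel of [(x - y)_+ ^ q = \int_y^x q (u - y)^(q-1) du]. The guard is
   needed because [powR] is 1 at negative reals. *)
Definition hinge x y u : R :=
  if (y <= u) && (u <= x) then q * (u - y) `^ (q - 1) else 0.

Lemma hinge_ge0 x y u : 0 <= hinge x y u.
Proof. by rewrite /hinge; case: ifP => // _; rewrite mulr_ge0 ?powR_ge0// ltW. Qed.

Definition pospow x y : R := (Num.max 0 (x - y)) `^ q.

Lemma absq_pospow x y : absq q (x - y) = pospow x y + pospow y x.
Proof.
rewrite /absq /pospow; have [xy|yx] := leP x y.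
  have -> : Num.max 0 (x - y) = 0 by apply/max_idPl; rewrite subr_le0.
  have -> : Num.max 0 (y - x) = y - x by apply/max_idPr; rewrite subr_ge0.
  by rewrite powR0 ?gt_eqF// add0r distrC ger0_norm// subr_ge0.
have -> : Num.max 0 (x - y) = x - y by apply/max_idPr; rewrite subr_ge0 ltW.
have -> : Num.max 0 (y - x) = 0 by apply/max_idPl; rewrite subr_le0 ltW.
by rewrite powR0 ?gt_eqF// addr0 ger0_norm// subr_ge0 ltW.
Qed.

Lemma pospow_ge0 x y : 0 <= pospow x y.
Proof. exact: powR_ge0. Qed.

(** Fundamental theorem of calculus on [[y, x]]. The primitive is taken as [|v - y|^q], which is
    continuous everywhere and equals [(v - y)^q] to the right of [y]. *)
Lemma integral_hinge x y :
  (\int[lebesgue_measure]_u (hinge x y u)%:E = (pospow x y)%:E)%E.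
Proof.
transitivity (\int[lebesgue_measure]_(u in `[y, x]) (q * (u - y) `^ (q - 1))%:E)%E.
  rewrite [RHS]integral_mkcond; apply: eq_integral => u _.
  by rewrite patchE /hinge mem_setE in_itv/=; case: ifP.
rewrite /pospow; have [xy|yx] := leP x y.
  have -> : Num.max 0 (x - y) = 0 by apply/max_idPl; rewrite subr_le0.
  rewrite powR0 ?gt_eqF//.
  move: xy; rewrite le_eqVlt => /orP[/eqP->|xy].
    by rewrite set_itv1 integral_set1.
  by rewrite set_itv_ge ?integral_set0// bnd_simp -ltNge.
have -> : Num.max 0 (x - y) = x - y by apply/max_idPr; rewrite subr_ge0 ltW.
have shift_cvg u : (fun v : R => v - y) @ u --> u - y.
  by apply: cvgB; [exact: cvg_id|exact: cvg_cst].
have dF u : u \in `]y, x[ ->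
    is_derive u 1 (fun v : R => (v - y) `^ q) (q * (u - y) `^ (q - 1)).
  rewrite in_itv/= => /andP[yu ux].
  have h1 : is_derive (u - y) 1 (@powR R ^~ q) (q * (u - y) `^ (q - 1)).
    by apply: is_derive1_powR; rewrite subr_gt0.
  have h2 : is_derive u 1 (fun v : R => v - y) (1 - 0) by exact: is_deriveB.
  have := @is_derive1_comp R (@powR R ^~ q) (fun v => v - y) u _ _ h1 h2.
  by rewrite subr0 mulr1.
have contF : continuous (fun v : R => absq q (v - y)).
  move=> u; apply: (@continuous_comp _ _ _ (fun v : R => v - y) (absq q)).
    exact: shift_cvg.
  exact: continuous_absq.
have near_absq u : y < u -> \forall v \near u, (v - y) `^ q = absq q (v - y).
  move=> yu; near=> v; rewrite /absq ger0_norm// subr_ge0 ltW//.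
  by near: v; exact: lt_nbhsr.
rewrite (@continuous_FTC2 R _ (fun v => absq q (v - y)))//.
- by rewrite subrr absq0// /absq ger0_norm ?subr_ge0 ?ltW// sube0.
(* For [q = 1] the integrand is constant, as a power with exponent 0 is 1 even at 0; for [q > 1] it
   agrees on [[y, x]] with a continuous function. *)
- have [->|qn1] := eqVneq q 1.
    under [X in continuous X]eq_fun do rewrite subrr powRr0 mulr1.
    by move=> u; exact: cvg_cst.
  have q10 : 0 < q - 1 by rewrite subr_gt0 lt_neqAle eq_sym qn1.
  apply: (@subspace_eq_continuous _ `[y, x]%classic R
      (fun v => q * absq (q - 1) (v - y))).
    move=> v; rewrite inE/= in_itv/= => /andP[yv _].
    by rewrite /absq ger0_norm// subr_ge0.
  apply: continuous_subspaceT => u; apply: cvgM; first exact: cvg_cst.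
  apply: (@continuous_comp _ _ _ (fun v : R => v - y) (absq (q - 1))).
    exact: shift_cvg.
  exact: continuous_absq.
- split.
  + move=> u uyx; have yu : y < u by move: uyx; rewrite in_itv/= => /andP[].
    by apply: (@near_eq_derivable R R^o R^o (fun v : R => (v - y) `^ q)
      (fun v => absq q (v - y)) u 1 (near_absq u yu)); have [] := dF u uyx.
  + by apply: cvg_at_right_filter; exact: contF.
  + by apply: cvg_at_left_filter; exact: contF.
- move=> u uyx; have yu : y < u by move: uyx; rewrite in_itv/= => /andP[].
  rewrite derive1E -(@near_eq_derive R R^o R^o _ _ u 1 (near_absq u yu)).
  by have [_ ->] := dF u uyx.
Unshelve. all: by end_near. Qed.

End hinge.

(** * Comonotone pairs minimize the cost *)

Section comonotone_cost.
Context {R : realType} {q : R} {d1 d2} {T1 : measurableType d1} {T2 : measurableType d2}.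
Hypothesis q1 : 1 <= q.

Lemma integral_pospow d (T : measurableType d) (P : probability T R) (X Y : T -> R) :
  measurable_fun [set: T] X -> measurable_fun [set: T] Y ->
  (\int[P]_t (pospow q (X t) (Y t))%:E =
   \int[lebesgue_measure]_u \int[P]_t (hinge q (X t) (Y t) u)%:E)%E /\
  measurable_fun [set: R] (fun u => \int[P]_t (hinge q (X t) (Y t) u)%:E)%E.
Proof.
move=> mX mY.
pose f (z : T * R) := (hinge q (X z.1) (Y z.1) z.2)%:E.
have mf : measurable_fun [set: T * R] f.
  apply/measurable_EFinP; rewrite /hinge; apply: measurable_fun_ifT.
  - apply: measurable_and; apply: measurable_fun_ler => //.
      exact: measurableT_comp.
    exact: measurableT_comp.
  - apply: measurable_funM => //.
    apply: (measurableT_comp (measurable_powR _)).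
    by apply: measurable_funB => //; exact: measurableT_comp.
  - exact: measurable_cst.
have f0 z : (0 <= f z)%E by rewrite lee_fin hinge_ge0.
split; last exact: (@measurable_fun_fubini_tonelli_G _ _ _ _ _ P f).
rewrite -(fubini_tonelli (m1 := P) (m2 := lebesgue_measure) f)//.
by apply: eq_integral => t _; rewrite -integral_hinge.
Qed.

Variables (P1 : probability T1 R) (P2 : probability T2 R).

(** Slicing first over the kernel variable [u], then over the kernel values [r], reduces the
    integrals to probabilities. Comonotonicity is asked only on a set [E] of full mass because
    quantile functions are controlled only on []0, 1[]. *)
Lemma comonotone_pospow_le (X1 Y1 : T1 -> R) (X2 Y2 : T2 -> R) (E : set T2) :
  measurable_fun [set: T1] X1 -> measurable_fun [set: T1] Y1 ->
  measurable_fun [set: T2] X2 -> measurable_fun [set: T2] Y2 ->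
  (forall A, measurable A -> P1 (X1 @^-1` A) = P2 (X2 @^-1` A)) ->
  (forall A, measurable A -> P1 (Y1 @^-1` A) = P2 (Y2 @^-1` A)) ->
  measurable E -> P2 (~` E) = 0%E ->
  (forall t t', E t -> E t' -> X2 t < X2 t' -> Y2 t <= Y2 t') ->
  (\int[P2]_t (pospow q (X2 t) (Y2 t))%:E <= \int[P1]_t (pospow q (X1 t) (Y1 t))%:E)%E.
Proof.
move=> mX1 mY1 mX2 mY2 eX eY mE E0 com.
have [-> mG1] := integral_pospow P1 mX1 mY1.
have [-> mG2] := integral_pospow P2 mX2 mY2.
apply: ge0_le_integral => //.
- by move=> u _; apply: integral_ge0 => t _; rewrite lee_fin hinge_ge0.
move=> u _.
have mh d (T : measurableType d) (X Y : T -> R) : measurable_fun [set: T] X ->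
    measurable_fun [set: T] Y ->
    measurable_fun [set: T] (fun t => hinge q (X t) (Y t) u).
  move=> mX mY; rewrite /hinge; apply: measurable_fun_ifT.
  - by apply: measurable_and; apply: measurable_fun_ler.
  - apply: measurable_funM => //.
    apply: (measurableT_comp (measurable_powR _)).
    exact: measurable_funB.
  - exact: measurable_cst.
have h0 x y := hinge_ge0 q1 x y u.
rewrite !ge0_layer_cake//; [|exact: mh|exact: mh].
apply: ge0_le_integral => //.
- by apply: measurable_funTS; apply: measurable_survival; exact: mh.
- by apply: measurable_funTS; apply: measurable_survival; exact: mh.
move=> r; rewrite /= in_itv/= andbT => r0.
(* The survival set of the kernel is [{Y in D} \ {X < u}] with [D] a lower set, so
   under a comonotone pair the two sets are nested. *)
pose D := [set y | y <= u /\ r < q * (u - y) `^ (q - 1)].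
have DE d (T : measurableType d) (X Y : T -> R) :
    [set t | r < hinge q (X t) (Y t) u] = (Y @^-1` D) `\` (X @^-1` `]-oo, u[).
  apply/seteqP; split => t /=; rewrite /hinge in_itv/=.
    case: ifP => [/andP[Yu uX] rh|_ /(le_lt_trans r0)]; last by rewrite ltxx.
    by split=> //; rewrite ltNge uX.
  by move=> [[Yu rh]] Xu; rewrite Yu leNgt; move/negP: Xu => ->.
have Ddown y y' : y' <= y -> D y -> D y'.
  move=> y'y [yu ry]; split; first exact: le_trans yu.
  apply: (lt_le_trans ry); rewrite ler_wpM2l ?(le_trans ler01)//.
  have y'u := le_trans y'y yu.
  by rewrite ge0_ler_powR ?nnegrE ?subr_ge0// lerB.
have mpre d (T : measurableType d) (X : T -> R) A : measurable_fun [set: T] X ->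
    measurable A -> measurable (X @^-1` A).
  by move=> mX mA; rewrite -[_ @^-1` _]setTI; exact: mX.
have mD : measurable D.
  have -> : D = [set` `]-oo, u]] `&`
      (fun y => q * (u - y) `^ (q - 1)) @^-1` [set` `]r, +oo[].
    by apply/seteqP; split=> y /=; rewrite !in_itv/= andbT.
  apply: measurableI => //; apply: mpre => //.
  apply: measurable_funM => //; apply: (measurableT_comp (measurable_powR _)).
  exact: measurable_funB.
rewrite !DE; apply: (@probability_setD_nested_le _ _ _ _ _ _ _ _ _ _ _ E) => //;
  do 1?[exact: mpre|exact: eX|exact: eY].
(* If the first inclusion fails, some [t'] has [Y2 t'] in [D] and [u <= X2 t']. Any [t] with
   [X2 t < u] then has [Y2 t <= Y2 t'], so [Y2 t] is in the lower set [D]. *)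
have [?|/existsNP[t' /not_implyP[[Yt' Et'] Xt']]] :=
  pselect (Y2 @^-1` D `&` E `<=` X2 @^-1` `]-oo, u[); first by right.
left => t [/=]; rewrite in_itv/= => Xt Et.
apply: Ddown Yt'; apply: com => //; apply: lt_le_trans Xt _.
by rewrite leNgt; apply/negP => h; apply: Xt'; rewrite /= in_itv.
Qed.

Lemma comonotone_cost_le (X1 Y1 : T1 -> R) (X2 Y2 : T2 -> R) (E : set T2) :
  measurable_fun [set: T1] X1 -> measurable_fun [set: T1] Y1 ->
  measurable_fun [set: T2] X2 -> measurable_fun [set: T2] Y2 ->
  (forall A, measurable A -> P1 (X1 @^-1` A) = P2 (X2 @^-1` A)) ->
  (forall A, measurable A -> P1 (Y1 @^-1` A) = P2 (Y2 @^-1` A)) ->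
  measurable E -> P2 (~` E) = 0%E ->
  (forall t t', E t -> E t' -> X2 t < X2 t' -> Y2 t <= Y2 t') ->
  (\int[P2]_t (absq q (X2 t - Y2 t))%:E <= \int[P1]_t (absq q (X1 t - Y1 t))%:E)%E.
Proof.
move=> mX1 mY1 mX2 mY2 eX eY mE E0 com.
have split d (T : measurableType d) (P : probability T R) (X Y : T -> R) :
    measurable_fun [set: T] X -> measurable_fun [set: T] Y ->
    (\int[P]_t (absq q (X t - Y t))%:E =
     \int[P]_t (pospow q (X t) (Y t))%:E + \int[P]_t (pospow q (Y t) (X t))%:E)%E.
  have mp (U V : T -> R) : measurable_fun [set: T] U -> measurable_fun [set: T] V ->
      measurable_fun [set: T] (fun t => (pospow q (U t) (V t))%:E).
    move=> mU mV; apply/measurable_EFinP.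
    apply: (measurableT_comp (measurable_powR _)).
    by apply: measurable_maxr => //; exact: measurable_funB.
  move=> mX mY; rewrite -ge0_integralD//; do ?[exact: mp].
  - by apply: eq_integral => t _; rewrite (absq_pospow q1) EFinD.
  - by move=> t _; rewrite lee_fin pospow_ge0.
  - by move=> t _; rewrite lee_fin pospow_ge0.
rewrite !split//; apply: leeD; first exact: (comonotone_pospow_le (E := E)).
(* By contraposition comonotonicity also holds with the two variables swapped. *)
apply: (comonotone_pospow_le (E := E)) => // t t' Et Et' Ytt'.
rewrite leNgt; apply/negP => /(com _ _ Et' Et).
by rewrite leNgt Ytt'.
Qed.

End comonotone_cost.

(** * Quantile functions *)

Section unit_uniform.
Context {R : realType}.
Local Open Scope ereal_scope.

Definition lam : probability (measurableTypeR R) R := uniform_prob (@ltr01 R).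

Lemma lamE (A : set R) : measurable A -> lam A = lebesgue_measure (A `&` `[0%R, 1%R]).
Proof.
move=> mA; rewrite /lam /= /uniform_prob integral_uniform_pdf.
rewrite (eq_integral (cst 1)) ?integral_cst ?mul1e//; first exact: measurableI.
by move=> x; rewrite inE/= in_itv/= /uniform_pdf => -[_ ->]; rewrite subr0 invr1.
Qed.

(** Only the endpoints 0 and 1 can contribute, and they are null. Hence quantile identities are
    needed only on the open interval. *)
Lemma lam_itvN (A : set R) : measurable A -> lam (A `\` `]0%R, 1%R[) = 0.
Proof.
move=> mA; apply/eqP; rewrite eq_le measure_ge0 andbT.
have m2 : measurable [set 0%R; 1%R : R] by apply: measurableU.
apply: (@le_trans _ _ (lebesgue_measure ([set 0%R; 1%R] : set R))).
  rewrite lamE; last exact: measurableD.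
  apply: le_measure; rewrite ?inE//.
    by apply: measurableI => //; exact: measurableD.
  move=> x [[_ /=]]; rewrite !in_itv/= => /negP + /andP[x0 x1].
  rewrite lt_neqAle x0 lt_neqAle x1 !andbT negb_and !negbK eq_sym.
  by move=> /orP[/eqP|/eqP] ->; [left|right].
have /= := @measureU2 _ _ _ lebesgue_measure [set 0%R] [set 1%R : R].
by rewrite !lebesgue_measure_set1 adde0; apply.
Qed.

Lemma lam_setI_unit (A : set R) : measurable A -> lam A = lam (A `&` `]0%R, 1%R[).
Proof.
move=> mA; have -> : lam A = lam (A `\` `]0%R, 1%R[) + lam (A `&` `]0%R, 1%R[).
  exact: measureDI.
by rewrite lam_itvN// add0e.
Qed.

Lemma lam_itvNy (A : set R) (c : R) : measurable A -> (0 <= c <= 1)%R ->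
  A `&` `]0%R, 1%R[ = `]-oo, c] `&` `]0%R, 1%R[ -> lam A = c%:E.
Proof.
move=> mA /andP[c0 c1] Ac.
rewrite lam_setI_unit// Ac -lam_setI_unit// lamE//.
have -> : `]-oo, c] `&` `[0%R, 1%R] = [set` `[0%R, c]].
  apply/seteqP; split => x /=; rewrite !in_itv/=; first by move=> [-> /andP[->]].
  by move=> /andP[-> xc]; rewrite xc (le_trans xc).
by rewrite lebesgue_measure_itv/= lte_fin; case: ltgtP c0 => // [_ _|<-//]; rewrite sube0.
Qed.

End unit_uniform.

Section measurable_monotone.
Context {R : realType}.

(** The part of [D] sent into a ray [[r, +oo[] is order-convex, hence an interval. *)
Lemma nondecreasing_in_measurable (D : set R) (f : R -> R) :
  measurable D -> is_interval D ->
  (forall x y, D x -> D y -> x <= y -> f x <= f y) -> measurable_fun D f.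
Proof.
move=> mD iD f_nd.
apply: (measurability (@RGenCInfty.G R)) => [|/= _ [_] [r] -> <-].
  exact: RGenCInfty.measurableE.
apply: is_interval_measurable => s t/=.
rewrite !in_itv/= !andbT => -[Ds fs] [Dt ft] u /andP[su ut].
have Du : D u by apply: (iD s t) => //; rewrite su ut.
by split => //; rewrite in_itv/= andbT (le_trans fs)// f_nd.
Qed.

End measurable_monotone.

Section quantile.
Context {R : realType}.
Variable mu : probability R R.
Let F := cdf_of mu.

Let idX : {RV mu >-> R} := HB.pack (idfun : R -> R)
  (isMeasurableFun.Build _ _ _ _ idfun (@measurable_id _ _ setT)).

Lemma cdf_ofE x : (cdf_of mu x)%:E = cdf idX x.
Proof. by rewrite /cdf_of fineK// fin_num_measure. Qed.

Let cdfE : cdf idX = EFin \o F.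
Proof. by apply/funext => x; rewrite -cdf_ofE. Qed.

Lemma cdf_of_homo x y : x <= y -> cdf_of mu x <= cdf_of mu y.
Proof. by move=> xy; rewrite -lee_fin !cdf_ofE cdf_nondecreasing. Qed.

Lemma cdf_of_ge0 x : 0 <= cdf_of mu x.
Proof. by rewrite -lee_fin cdf_ofE cdf_ge0. Qed.

Lemma cdf_of_le1 x : cdf_of mu x <= 1.
Proof. by rewrite -lee_fin cdf_ofE cdf_le1. Qed.

Lemma measurable_cdf_of : measurable_fun [set: R] (cdf_of mu).
Proof. by apply: nondecreasing_measurable => // x y; exact: cdf_of_homo. Qed.

Let S u := [set x : R | u <= F x].

Lemma quantile_has_inf u : 0 < u < 1 -> has_inf (S u).
Proof.
move=> /andP[u0 u1]; split.
  have /fine_cvg : cdf idX x @[x --> +oo] --> 1%:E by exact: cvg_cdfy1.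
  rewrite cdfE => /cvgr_ge /(_ _ u1) [M [_ MF]].
  by exists (M + 1); apply: MF; rewrite ltrDl.
have /fine_cvg : cdf idX x @[x --> -oo] --> 0%:E by exact: cvg_cdfNy0.
rewrite cdfE => /cvgr_lt /(_ _ u0) [M [_ MF]].
exists (M - 1) => x /= ux; rewrite leNgt; apply/negP => xM.
have := le_lt_trans (cdf_of_homo (ltW xM)) (MF (M - 1) _).
by rewrite /= ltrBlDr ltrDl ltr01 => /(_ isT); rewrite ltNge ux.
Qed.

(** Right continuity: a value below [u] at the quantile would persist slightly to its right, where
    points of the defining set accumulate. *)
Lemma cdf_quantile_ge u : 0 < u < 1 -> u <= cdf_of mu (quantile_of mu u).
Proof.
move=> u01; rewrite leNgt; apply/negP => ltu.
set Q := quantile_of mu u in ltu.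
have /fine_cvg : cdf idX x @[x --> Q^'+] --> (F Q)%:E.
  by rewrite cdf_ofE; exact: cdf_right_continuous.
rewrite cdfE => /cvgr_lt /(_ _ ltu) [e /= e0 He].
have [x ux xQ] := inf_adherent e0 (quantile_has_inf u01).
have Qx : Q <= x by apply: ge_inf => //; exact: (quantile_has_inf u01).2.
move: Qx; rewrite le_eqVlt => /orP[/eqP Qx|Qx].
  by move: ltu; rewrite Qx ltNge; move/negP; exact.
have := He x; rewrite /= distrC ger0_norm ?subr_ge0 ?ltW// ltrBlDl.
by move=> /(_ xQ Qx); rewrite ltNge; move/negP; exact.
Qed.

(** The Galois connection that yields both the monotonicity of the quantile and its law. *)
Lemma quantile_le u v : 0 < u < 1 ->
  (quantile_of mu u <= v) = (u <= cdf_of mu v).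
Proof.
move=> u01; apply/idP/idP => [Qv|uv].
  by rewrite (le_trans (cdf_quantile_ge u01))// cdf_of_homo.
by apply: ge_inf => //; exact: (quantile_has_inf u01).2.
Qed.

Lemma quantile_homo u u' : 0 < u < 1 -> 0 < u' < 1 -> u <= u' ->
  quantile_of mu u <= quantile_of mu u'.
Proof.
by move=> u01 u'01 uu'; rewrite quantile_le// (le_trans uu')// cdf_quantile_ge.
Qed.

(* Outside ]0, 1[ the infimum defining [quantile_of] may be a junk value. *)
Definition unit_quantile : R -> R := (quantile_of mu) \_ `]0, 1[.

Lemma unit_quantileE u : 0 < u < 1 -> unit_quantile u = quantile_of mu u.
Proof. by move=> u01; rewrite /unit_quantile patchE mem_set//= in_itv. Qed.

Lemma measurable_unit_quantile : measurable_fun [set: R] unit_quantile.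
Proof.
apply: (measurable_restrictT _ _).1 => //.
apply: nondecreasing_in_measurable => //; first exact: interval_is_interval.
by move=> x y /=; rewrite !in_itv; exact: quantile_homo.
Qed.

(** Inverse transform sampling: the Galois connection settles the rays []-oo, v]], and their
    complements form a generating class closed under intersection. *)
Lemma lam_unit_quantile (A : set R) : measurable A ->
  lam (unit_quantile @^-1` A) = mu A.
Proof.
move=> mA.
have mQ : measurable_fun [set: measurableTypeR R] (unit_quantile : measurableTypeR R -> R).
  exact: measurable_unit_quantile.
pose Q : {RV (lam : probability (measurableTypeR R) R) >-> R} :=
  HB.pack (unit_quantile : measurableTypeR R -> R)
    (@isMeasurableFun.Build _ _ (measurableTypeR R) R unit_quantile mQ).
have QNy v : distribution lam Q [set` `]-oo, v]] = mu [set` `]-oo, v]].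
  rewrite -[RHS]fineK ?fin_num_measure//.
  apply: lam_itvNy.
  - by rewrite -[_ @^-1` _]setTI; exact: measurable_unit_quantile.
  - by rewrite cdf_of_ge0 cdf_of_le1.
  - apply/seteqP; split => u /=; rewrite !in_itv/= => -[+ u01]; rewrite unit_quantileE//.
      by rewrite quantile_le.
    by rewrite quantile_le.
rewrite -[LHS]/(distribution lam Q A).
apply: (measure_unique (@RGenOInfty.G R) (fun n => `](- n%:R), +oo[%classic)) => //.
- exact: RGenOInfty.measurableE.
- move=> _ _ [x ->] [y ->]; exists (Num.max x y).
  by apply/seteqP; split=> z /=; rewrite !in_itv/= !andbT gt_max => /andP.
- by move=> n; exists (- n%:R).
- rewrite -subTset => x _; exists (Num.bound x) => //=.
  by rewrite in_itv/= andbT ltrNl unstable.ltrNbound.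
- move=> _ [x ->]; rewrite -setCitvl.
  transitivity (1 - distribution lam Q [set` `]-oo, x]])%E; first exact: probability_setC.
  by rewrite QNy; apply/esym/probability_setC.
- by move=> n; rewrite -ge0_fin_numE// fin_num_measure.
Qed.

(** Without atoms, the distribution function at [Q] is the mass of []-oo, Q[]. By inverse sampling
    this is the measure of the levels whose quantile is below [Q]; these lie below [u] by
    monotonicity. *)
Lemma cdf_quantile u : (forall x, mu [set x] = 0%E) -> 0 < u < 1 ->
  cdf_of mu (quantile_of mu u) = u.
Proof.
move=> mu0 u01; apply/eqP; rewrite eq_le cdf_quantile_ge// andbT.
set Q := quantile_of mu u.
have -> : cdf_of mu Q = fine (mu [set` `]-oo, Q[]).
  rewrite /cdf_of; congr fine.
  have -> : [set` `]-oo, Q]] = [set` `]-oo, Q[] `|` [set Q] by rewrite setUitv1.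
  apply/eqP; rewrite eq_le; apply/andP; split.
    apply: (@le_trans _ _ (mu [set` `]-oo, Q[] + mu [set Q]))%E.
      exact: measureU2.
    by rewrite mu0 adde0.
  by apply: le_measure; rewrite ?inE//; exact: measurableU.
rewrite -lee_fin fineK ?fin_num_measure// -lam_unit_quantile//.
have /andP[u0 u1] := u01.
rewrite -(@lam_itvNy _ `]-oo, u] u)//; last by rewrite !ltW.
have mQ : measurable (unit_quantile @^-1` `]-oo, Q[).
  by rewrite -[_ @^-1` _]setTI; exact: measurable_unit_quantile.
rewrite lam_setI_unit// [leRHS]lam_setI_unit//.
apply: le_measure; rewrite ?inE//; [exact: measurableI|exact: measurableI|].
move=> v [vQ v01]; split=> //; move: v01 vQ; rewrite /= !in_itv/= => v01.
rewrite unit_quantileE// => vQ; rewrite leNgt; apply/negP => /ltW/quantile_homo.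
by move=> /(_ u01 v01); rewrite leNgt vQ.
Qed.

End quantile.

(** * Conditional laws and transport costs *)

Section conditioning.
Context {R : realType} {d} {T : measurableType d}.
Variables (P : probability T R) (D : set T).
Hypotheses (mD : measurable D) (PD : (0 < P D)%E).

Lemma fine_inv_ge0 : 0 <= (fine (P D))^-1.
Proof. by rewrite invr_ge0 fine_ge0. Qed.

(** The positivity proof is carried by the term so that the probability structure can be attached to
    it. *)
Definition cond_prob & (0 < P D)%E : set T -> \bar R :=
  mscale (NngNum fine_inv_ge0) (mrestr P mD).

HB.instance Definition _ := Measure.on (cond_prob PD).

Lemma cond_probE A : cond_prob PD A = (P (A `&` D) * (fine (P D))^-1%:E)%E.
Proof. by rewrite muleC. Qed.

Let cond_prob_setT : cond_prob PD [set: T] = 1%E.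
Proof.
rewrite cond_probE setTI -[X in (X * _)%E](fineK (fin_num_measure P _ mD)).
rewrite -EFinM mulfV// gt_eqF// fine_gt0// PD/=.
by rewrite -ge0_fin_numE// fin_num_measure.
Qed.

HB.instance Definition _ := Measure_isProbability.Build _ _ _
  (cond_prob PD) cond_prob_setT.

Lemma ge0_integral_cond_prob (f : T -> \bar R) :
  measurable_fun [set: T] f -> (forall t, 0 <= f t)%E ->
  (\int[cond_prob PD]_t f t = (\int[P]_(t in D) f t) * (fine (P D))^-1%:E)%E.
Proof.
move=> mf f0; rewrite ge0_integral_mscale//= muleC; congr (_ * _)%E.
have -> : (\int[P]_(t in D) f t = \int[mrestr P mD]_(t in D) f t)%E.
  by apply: eq_measure_integral => A mA AD; rewrite /= /mrestr setIidl.
rewrite (@ge0_negligible_integral _ _ _ (mrestr P mD) setT (~` D))//.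
- by rewrite setTD setCK.
- exact: measurableC.
- by rewrite /= /mrestr setICl measure0.
Qed.

End conditioning.

Section law.
Context {R : realType} {d} {T : measurableType d} (P : probability T R).

(** Equality is stated between set functions so that it can be rewritten inside [Wqq], which takes
    bare set functions. *)
Lemma law_exists (Y : T -> R) : measurable_fun [set: T] Y ->
  exists mu : probability R R, (mu : set R -> \bar R) = (fun A => P (Y @^-1` A)).
Proof.
move=> mY.
pose Z : {RV P >-> R} := HB.pack Y (isMeasurableFun.Build _ _ _ _ Y mY).
by exists (distribution P Z).
Qed.

Lemma integral_law (mu : probability R R) (Y : T -> R) (f : R -> \bar R) :
  measurable_fun [set: T] Y ->
  (forall A, measurable A -> mu A = P (Y @^-1` A)) ->
  measurable_fun [set: R] f -> (forall y, 0 <= f y)%E ->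
  (\int[mu]_y f y = \int[P]_t f (Y t))%E.
Proof.
move=> mY muE mf f0.
pose Z : {RV P >-> R} := HB.pack Y (isMeasurableFun.Build _ _ _ _ Y mY).
rewrite -[RHS](ge0_integral_distribution Z)//.
by apply: eq_measure_integral => A mA _; exact: muE.
Qed.

End law.

Section unit_integral.
Context {R : realType}.

Lemma integral_lam_unit (f : R -> \bar R) :
  measurable_fun [set: R] f -> (forall y, 0 <= f y)%E ->
  (\int[lam]_u f u = \int[lam]_(u in `]0%R, 1%R[) f u)%E.
Proof.
move=> mf f0; rewrite (@ge0_negligible_integral _ _ _ lam setT (~` `]0%R, 1%R[))//.
- by rewrite setTD setCK.
- exact: measurableC.
- by rewrite -setTD; exact: lam_itvN.
Qed.

Lemma le_integral_lam (f g : R -> \bar R) :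
  measurable_fun [set: R] f -> (forall y, 0 <= f y)%E ->
  measurable_fun [set: R] g -> (forall y, 0 <= g y)%E ->
  (forall u, (0 < u < 1)%R -> f u <= g u)%E ->
  (\int[lam]_u f u <= \int[lam]_u g u)%E.
Proof.
move=> mf f0 mg g0 fg; rewrite integral_lam_unit// [leRHS]integral_lam_unit//.
apply: ge0_le_integral => //; exact: measurable_funTS.
Qed.

Lemma eq_integral_lam (f g : R -> \bar R) :
  measurable_fun [set: R] f -> (forall y, 0 <= f y)%E ->
  measurable_fun [set: R] g -> (forall y, 0 <= g y)%E ->
  (forall u, (0 < u < 1)%R -> f u = g u)%E ->
  (\int[lam]_u f u = \int[lam]_u g u)%E.
Proof.
move=> mf f0 mg g0 fg; apply/eqP; rewrite eq_le.
by apply/andP; split; apply: le_integral_lam => // u /fg ->.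
Qed.

End unit_integral.

Section wasserstein.
Context {R : realType} (q : R).
Hypothesis q1 : 1 <= q.

Lemma measurable_absqB d (T : measurableType d) (X Y : T -> R) :
  measurable_fun [set: T] X -> measurable_fun [set: T] Y ->
  measurable_fun [set: T] (fun t => (absq q (X t - Y t))%:E).
Proof.
move=> mX mY; apply/measurable_EFinP.
by apply: (measurableT_comp (@measurable_absq R q)) => //; exact: measurable_funB.
Qed.

(** The cost of the comonotone coupling, driven by one uniform variable. *)
Definition quantile_cost (mu nu : probability R R) : \bar R :=
  (\int[lam]_u (absq q (unit_quantile mu u - unit_quantile nu u))%:E)%E.

Lemma quantile_cost_le d (T : measurableType d) (P : probability T R) (X Y : T -> R)
    (mu nu : probability R R) :
  measurable_fun [set: T] X -> measurable_fun [set: T] Y ->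
  (forall A, measurable A -> mu A = P (X @^-1` A)) ->
  (forall A, measurable A -> nu A = P (Y @^-1` A)) ->
  (quantile_cost mu nu <= \int[P]_t (absq q (X t - Y t))%:E)%E.
Proof.
move=> mX mY muE nuE.
apply: (@comonotone_cost_le _ _ _ _ _ _ q1 P lam X Y _ _ `]0, 1[%classic) => //.
- exact: measurable_unit_quantile.
- exact: measurable_unit_quantile.
- by move=> A mA; rewrite -muE//; apply/esym; exact: lam_unit_quantile.
- by move=> A mA; rewrite -nuE//; apply/esym; exact: lam_unit_quantile.
- by rewrite -setTD; exact: lam_itvN.
move=> u u'; rewrite /= !in_itv/= => u01 u'01; rewrite !unit_quantileE// => ltu.
apply: quantile_homo => //; rewrite leNgt; apply/negP => /ltW/quantile_homo.
by move=> /(_ mu u'01 u01); rewrite leNgt ltu.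
Qed.

Lemma quantile_cost_le_Wqq (mu nu : probability R R) :
  (quantile_cost mu nu <= Wqq q mu nu)%E.
Proof.
apply: le_ereal_inf_tmp => _ [pi [pi1 pi2] <-].
apply: (@quantile_cost_le _ _ pi fst snd) => // A mA.
  by rewrite -pi1//; congr (pi _); apply/seteqP; split => -[x y] //= [].
by rewrite -pi2//; congr (pi _); apply/seteqP; split => -[x y] //= [].
Qed.

Lemma Wqq_le_cost d (T : measurableType d) (P : probability T R) (X Y : T -> R)
    (mu nu : set R -> \bar R) :
  measurable_fun [set: T] X -> measurable_fun [set: T] Y ->
  (forall A, measurable A -> mu A = P (X @^-1` A)) ->
  (forall A, measurable A -> nu A = P (Y @^-1` A)) ->
  (Wqq q mu nu <= \int[P]_t (absq q (X t - Y t))%:E)%E.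
Proof.
move=> mX mY muE nuE.
have mXY : measurable_fun [set: T] (fun t => (X t, Y t)).
  exact: measurable_fun_pair.
pose Z : {RV P >-> (R * R)%type} :=
  HB.pack (fun t => (X t, Y t)) (isMeasurableFun.Build _ _ _ _ _ mXY).
apply: ereal_inf_le; exists (\int[P]_t (absq q (X t - Y t))%:E)%E => //.
exists (distribution P Z).
  split=> A mA; rewrite /= /pushforward; [rewrite muE//|rewrite nuE//];
    by congr (P _); apply/seteqP; split => t //= [].
rewrite (ge0_integral_distribution Z)//; last by move=> z; rewrite lee_fin absq_ge0.
exact: (@measurable_absqB _ _ fst snd).
Qed.

End wasserstein.

(* Otherwise closing tactics may unfold infima of real sets during unification. *)
Opaque least_mean.

(** * Barycenters and repair *)

Section barycenter.
Context {R : realType} (q : R) {K : nat} (w : 'I_K -> R).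
Variable nu : 'I_K -> probability R R.
Hypothesis q1 : 1 <= q.
Hypothesis w0 : forall s, 0 <= w s.
Hypothesis w1 : \sum_(s < K) w s = 1.

Let Q s := unit_quantile (nu s).
Let mQ s : measurable_fun [set: R] (Q s). Proof. exact: measurable_unit_quantile. Qed.

Definition barycenter_quantile (u : R) : R :=
  least_mean q w (fun s => quantile_of (nu s) u).

(* The closed interval is kept because [cdf_of] can take the values 0 and 1. *)
Definition unit_barycenter : R -> R := barycenter_quantile \_ `[0, 1].

Let B := unit_barycenter.

Lemma unit_barycenterE u : 0 <= u <= 1 -> unit_barycenter u = barycenter_quantile u.
Proof. by move=> u01; rewrite /unit_barycenter patchE mem_set//= in_itv. Qed.

(** Monotone on []0, 1[], where the quantiles are genuine infima; the endpoints are added as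
    singletons. *)
Lemma measurable_unit_barycenter : measurable_fun [set: R] unit_barycenter.
Proof.
apply: (measurable_restrictT _ _).1 => //.
have -> : `[0, 1]%classic = `]0, 1[ `|` ([set 0] `|` [set 1]) :> set R.
  apply/seteqP; split => x /=; rewrite !in_itv/=.
    move=> /andP[]; rewrite le_eqVlt => /orP[/eqP<-|x0]; first by right; left.
    rewrite le_eqVlt => /orP[/eqP->|x1]; first by right; right.
    by left; rewrite x0.
  by move=> [/andP[? ?]|[->|->]]; rewrite ?lexx ?ler01 ?ltW.
have m1 x : measurable_fun [set x] barycenter_quantile by exact: measurable_fun_set1.
apply/measurable_funU => //; first exact: measurableU.
split; last by apply/measurable_funU.
apply: nondecreasing_in_measurable.
- exact: measurable_itv.
- exact: interval_is_interval.
move=> x y.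
rewrite /= !in_itv/=.
move=> x01 y01 xy.
apply: (least_mean_homo q1 w0 w1) => s.
exact: quantile_homo.
Qed.

Local Open Scope ereal_scope.

Definition barycenter_cost : \bar R :=
  \sum_(s < K) (w s)%:E * \int[lam]_u (absq q (Q s u - B u)%R)%:E.

Let absqE_ge0 x : 0 <= (absq q x)%:E. Proof. by rewrite lee_fin absq_ge0. Qed.

Lemma wsum_integral d (T : measurableType d) (P : {measure set T -> \bar R}) (f : 'I_K -> T -> R) :
  (forall s, measurable_fun [set: T] (f s)) -> (forall s t, (0 <= f s t)%R) ->
  \sum_(s < K) (w s)%:E * \int[P]_t (f s t)%:E =
  \int[P]_t (\sum_(s < K) w s * f s t)%:E.
Proof.
move=> mf f0.
under [RHS]eq_integral do rewrite -sumEFin.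
rewrite ge0_integral_sum//.
- apply: eq_bigr => s _; under [RHS]eq_integral do rewrite EFinM.
  rewrite ge0_integralZl ?lee_fin//.
    exact/measurable_EFinP.
  by move=> t _; rewrite lee_fin.
- by move=> s; apply/measurable_EFinP; exact: measurable_funM.
- by move=> s t _; rewrite lee_fin mulr_ge0.
Qed.

Let m_absqB (f g : R -> R) : measurable_fun [set: R] f -> measurable_fun [set: R] g ->
  measurable_fun [set: R] (fun u => absq q (f u - g u)%R).
Proof. by move=> mf mg; apply/measurable_EFinP; exact: measurable_absqB. Qed.

Lemma barycenter_cost_le_fun (f : R -> R) : measurable_fun [set: R] f ->
  barycenter_cost <= \sum_(s < K) (w s)%:E * \int[lam]_u (absq q (Q s u - f u)%R)%:E.
Proof.
move=> mf.
have mB := measurable_unit_barycenter.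
have msum (g : R -> R) : measurable_fun [set: R] g ->
    measurable_fun [set: R] (fun u => (\sum_(s < K) w s * absq q (Q s u - g u))%R%:E).
  move=> mg; apply/measurable_EFinP; apply: measurable_sum => s.
  by apply: measurable_funM => //; exact: m_absqB.
have sum0 (g : R -> R) u : 0 <= (\sum_(s < K) w s * absq q (Q s u - g u))%R%:E.
  by rewrite lee_fin sumr_ge0// => s _; rewrite mulr_ge0// absq_ge0.
rewrite /barycenter_cost !wsum_integral => [|s|s u|s|s u]; rewrite ?absq_ge0//;
  do ?exact: m_absqB.
apply: le_integral_lam => //; [exact: msum|exact: msum|].
move=> u u01; rewrite lee_fin.
have /andP[u0 u1] := u01.
have := least_meanP q1 w0 w1 (fun s => quantile_of (nu s) u) (f u).
rewrite /dispersion /B unit_barycenterE; last by rewrite !ltW.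
by under [X in _ -> (_ <= X)%R]eq_bigr do rewrite /Q unit_quantileE//;
  under [X in _ -> (X <= _)%R]eq_bigr do rewrite /Q unit_quantileE//.
Qed.

Lemma barycenter_cost_le (mu : probability R R) :
  barycenter_cost <= \sum_(s < K) (w s)%:E * quantile_cost q (nu s) mu.
Proof. exact: (barycenter_cost_le_fun (measurable_unit_quantile mu)). Qed.

Hypothesis moment : forall s, finite_moment q (nu s).

Lemma moment_quantile s :
  \int[lam]_u (absq q (Q s u))%:E = \int[nu s]_y (absq q y)%:E.
Proof.
apply/esym; apply: (@integral_law _ _ _ lam (nu s) (Q s)) => //.
- exact: mQ.
- by move=> A mA; symmetry; exact: lam_unit_quantile.
- by apply/measurable_EFinP; exact: measurable_absq.
Qed.

Lemma barycenter_cost_lty : barycenter_cost < +oo.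
Proof.
apply: (@le_lt_trans _ _
    (* The zero function is a competitor whose cost is the weighted sum of the [q]-th moments. *)
    (\sum_(s < K) (w s)%:E * \int[lam]_u (absq q (Q s u - 0)%R)%:E)).
  by apply: (@barycenter_cost_le_fun (fun=> 0%R)); exact: measurable_cst.
apply: lte_sum_pinfty => s _; apply: lte_mul_pinfty; rewrite ?lee_fin//.
under eq_integral do rewrite subr0.
by rewrite moment_quantile; exact: moment.
Qed.

(** Write [B = (B - Q s) + Q s] for a group of positive weight: the first part has finite cost
    because [barycenter_cost] is finite, the second by the moment assumption. *)
Lemma barycenter_moment : \int[lam]_u (absq q (B u))%:E < +oo.
Proof.
have mB := measurable_unit_barycenter.
have [s ws] := exists_weight_gt0 w0 w1.
have costs : \int[lam]_u (absq q (Q s u - B u)%R)%:E < +oo.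
  rewrite ltNge leye_eq; apply/negP => /eqP costy.
  have : (w s)%:E * \int[lam]_u (absq q (Q s u - B u)%R)%:E <= barycenter_cost.
    rewrite /barycenter_cost (bigD1 s)//= leeDl//; apply: sume_ge0 => i _.
    by rewrite mule_ge0 ?lee_fin// integral_ge0.
  by rewrite costy gt0_muley ?lte_fin// leNgt barycenter_cost_lty.
(* Splitting at one half gives both parts the same constant [c]. *)
have h : (0 < (2^-1 : R) < 1)%R by lra.
pose c := ((2^-1 : R) `^ (1 - q))%R.
have c0 : (0 <= c)%R by exact: powR_ge0.
have mabs (f : R -> R) : measurable_fun [set: R] f ->
    measurable_fun [set: R] (fun u => (absq q (f u))%:E).
  by move=> mf; apply/measurable_EFinP; exact: (measurableT_comp (@measurable_absq R q)).
have mQB : measurable_fun [set: R] (fun u => (absq q (Q s u - B u)%R)%:E).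
  exact: measurable_absqB.
apply: (@le_lt_trans _ _ (\int[lam]_u
    (c%:E * (absq q (Q s u - B u)%R)%:E + c%:E * (absq q (Q s u))%:E))).
  apply: ge0_le_integral => //.
  - exact: mabs.
  - apply: emeasurable_funD; apply: emeasurable_funM => //; exact: mabs.
  move=> u _; rewrite -!EFinM -EFinD lee_fin.
  have := @absq_split _ _ q1 2^-1 (B u - Q s u) (Q s u) h.
  by rewrite subrK absqC (_ : 1 - 2^-1 = 2^-1 :> R)%R//; lra.
rewrite ge0_integralD//; first last.
- by apply: emeasurable_funM => //; exact: mabs.
- by move=> u _; rewrite mule_ge0 ?lee_fin ?absq_ge0.
- by apply: emeasurable_funM.
- by move=> u _; rewrite mule_ge0 ?lee_fin ?absq_ge0.
rewrite !ge0_integralZl ?lee_fin//; last exact: mabs.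
have Qs : \int[lam]_u (absq q (Q s u))%:E < +oo.
  by rewrite moment_quantile; exact: moment.
have c0E : 0 <= c%:E by rewrite lee_fin.
exact: (lte_add_pinfty (lte_mul_pinfty c0E isT costs) (lte_mul_pinfty c0E isT Qs)).
Qed.

End barycenter.

Opaque quantile_of.

(** * Risk and unfairness of repaired predictions *)

Section fair_repair.
Context {R : realType} {d} {T : measurableType d} (q : R) {K : nat} (w : 'I_K -> R).
Variables (Pc : 'I_K -> probability T R) (Y : 'I_K -> T -> R).
Variable nu : 'I_K -> probability R R.
Hypothesis q1 : 1 <= q.
Hypothesis w0 : forall s, 0 <= w s.
Hypothesis w1 : \sum_(s < K) w s = 1.
Hypothesis mY : forall s, measurable_fun [set: T] (Y s).
Hypothesis nuE : forall s, (nu s : set R -> \bar R) = (fun A => Pc s (Y s @^-1` A)).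
Hypothesis atomless : forall s x, nu s [set x] = 0%E.
Hypothesis moment : forall s, finite_moment q (nu s).
Local Open Scope ereal_scope.

Let q0 : (0 < q)%R. Proof. exact: lt_le_trans ltr01 q1. Qed.

Variable B : R -> R.
Hypothesis mB : measurable_fun [set: R] B.
Hypothesis momentB : \int[lam]_u (absq q (B u))%:E < +oo.
(** The constant [C], for an abstract map [B] in the role of the barycenter quantile; [costP]
    records its minimality. *)
Let cost : \bar R :=
  \sum_(s < K) (w s)%:E * \int[lam]_u (absq q (unit_quantile (nu s) u - B u)%R)%:E.
Hypothesis costP : forall m : probability R R,
  cost <= \sum_(s < K) (w s)%:E * quantile_cost q (nu s) m.

Definition risk (V W : 'I_K -> T -> R) : \bar R :=
  \sum_(s < K) (w s)%:E * \int[Pc s]_t (absq q (V s t - W s t)%R)%:E.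

Definition unfairness (V : 'I_K -> T -> R) : \bar R :=
  ereal_inf [set \sum_(s < K) (w s)%:E * Wqq q (fun A => Pc s (V s @^-1` A)) m
            | m in [set m : probability R R | finite_moment q m]].

(** Each outcome is replaced by the barycenter value at its rank within its group. *)
Definition repaired (s : 'I_K) (t : T) : R := B (cdf_of (nu s) (Y s t)).

Let mBF s : measurable_fun [set: R] (fun y => B (cdf_of (nu s) y)).
Proof. exact: (measurableT_comp mB (measurable_cdf_of (nu s))). Qed.

Lemma measurable_repaired s : measurable_fun [set: T] (repaired s).
Proof. exact: (measurableT_comp (mBF s) (mY s)). Qed.

Let BFQ s u : (0 < u < 1)%R -> B (cdf_of (nu s) (unit_quantile (nu s) u)) = B u.
Proof. by move=> u01; rewrite (unit_quantileE _ u01) (cdf_quantile (atomless s) u01). Qed.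

(** Realize [nu s] as the law of its quantile at a uniform [u]. Without atoms the rank of that
    quantile is [u], so the repaired value is [B u]. *)
Lemma risk_repaired : risk repaired Y = cost.
Proof.
apply: eq_bigr => s _; congr (_ * _).
pose h (y : R) := (absq q (B (cdf_of (nu s) y) - y)%R)%:E.
have mid : measurable_fun [set: R] (fun y : R => y) by [].
have mh : measurable_fun [set: R] h := measurable_absqB q (mBF s) mid.
have h0 y : 0 <= h y by rewrite lee_fin absq_ge0.
have mQ := measurable_unit_quantile (nu s).
rewrite -(@integral_law _ _ _ (Pc s) (nu s) (Y s) h)//; last by move=> A _; rewrite nuE.
have lawQ A : measurable A -> nu s A = lam (unit_quantile (nu s) @^-1` A).
  by move=> mA; symmetry; exact: lam_unit_quantile.
rewrite (@integral_law _ _ _ lam (nu s) (unit_quantile (nu s)) h mQ lawQ mh h0).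
apply: eq_integral_lam.
- exact: (measurableT_comp mh).
- by move=> y; exact: h0.
- exact: measurable_absqB.
- by move=> y; rewrite lee_fin absq_ge0.
by move=> u u01; rewrite /h BFQ// absqC.
Qed.

(** Ranks are uniform in every group, so all repaired outcomes share the law of [B] under [lam]. *)
Lemma repaired_law : exists2 m : probability R R, finite_moment q m &
  forall s A, measurable A -> m A = Pc s (repaired s @^-1` A).
Proof.
have [m mE] := @law_exists _ _ _ lam B mB.
exists m.
  rewrite /finite_moment (@integral_law _ _ _ lam m B)//.
  - by move=> A mA; rewrite mE.
  - by apply/measurable_EFinP; exact: measurable_absq.
  - by move=> y; rewrite lee_fin absq_ge0.
move=> s A mA; rewrite mE.
have mpre (f : R -> R) (C : set R) : measurable_fun [set: R] f -> measurable C ->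
    measurable (f @^-1` C).
  by move=> mf mC; rewrite -[_ @^-1` _]setTI; exact: mf.
have mQ := measurable_unit_quantile (nu s).
have -> : Pc s (repaired s @^-1` A) = nu s ((fun y => B (cdf_of (nu s) y)) @^-1` A).
  exact: (esym (congr1 (fun f => f _) (nuE s))).
rewrite -lam_unit_quantile; last exact: mpre.
rewrite lam_setI_unit; last exact: mpre.
rewrite [RHS]lam_setI_unit; last exact: (mpre _ _ mQ (mpre _ _ (mBF s) mA)).
congr (lam _); apply/seteqP; split => u /= [+ u01]; have := u01; rewrite /= in_itv/= => u01';
  by rewrite BFQ.
Qed.

(** The common repaired law competes in the infimum, and [V s] with [repaired s] form a coupling. *)
Lemma unfairness_le_risk V : (forall s, measurable_fun [set: T] (V s)) ->
  unfairness V <= risk V repaired.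
Proof.
move=> mV; have [m fm mE] := repaired_law.
apply: ereal_inf_le; eexists; first by exists m.
apply: lee_sum => s _; apply: lee_wpmul2l; first by rewrite lee_fin.
apply: Wqq_le_cost => //; [exact: measurable_repaired|exact: mE].
Qed.

(** With [n] the law of [V s], the gap between the quantiles of [nu s] and [m] is split at the
    quantile of [n]. After integration the risk bounds one piece and the transport cost the
    other. *)
Lemma cost_le_risk_Wqq V (m : probability R R) (t : R) :
  (forall s, measurable_fun [set: T] (V s)) -> (0 < t < 1)%R ->
  cost <= (t `^ (1 - q))%:E * risk V Y +
          ((1 - t) `^ (1 - q))%:E *
          \sum_(s < K) (w s)%:E * Wqq q (fun A => Pc s (V s @^-1` A)) m.
Proof.
move=> mV t01; have /andP[t0 t1] := t01.
have mQ := @measurable_unit_quantile R.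
have ct0 : (0 <= t `^ (1 - q))%R by exact: powR_ge0.
have ct1 : (0 <= (1 - t) `^ (1 - q))%R by exact: powR_ge0.
have Wge0 mu n : 0 <= Wqq q mu n.
  by apply: le_ereal_inf_tmp => _ [p _ <-]; apply: integral_ge0 => z _; rewrite lee_fin absq_ge0.
rewrite /risk !ge0_sume_distrr; first last.
- by move=> s _; rewrite mule_ge0 ?lee_fin// integral_ge0// => u _; rewrite lee_fin absq_ge0.
- by move=> s _; rewrite mule_ge0 ?lee_fin.
rewrite -big_split/=; apply: (le_trans (costP m)).
apply: lee_sum => s _; rewrite !(muleCA _ (w s)%:E) -ge0_muleDr; first last.
- by rewrite mule_ge0 ?lee_fin.
- by rewrite mule_ge0 ?lee_fin// integral_ge0// => u _; rewrite lee_fin absq_ge0.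
apply: lee_wpmul2l; first by rewrite lee_fin.
have [n nE] := law_exists (Pc s) (mV s).
rewrite -nE.
have le1 : quantile_cost q n (nu s) <= \int[Pc s]_u (absq q (V s u - Y s u)%R)%:E.
  by apply: (quantile_cost_le q1 (mV s) (mY s)) => A mA; [rewrite nE|rewrite nuE].
have le2 := quantile_cost_le_Wqq q1 n m.
apply: le_trans (leeD (lee_wpmul2l _ le1) (lee_wpmul2l _ le2)); rewrite ?lee_fin//.
rewrite /quantile_cost.
have mD (f g : probability R R) :
    measurable_fun [set: R] (fun u => (absq q (unit_quantile f u - unit_quantile g u)%R)%:E).
  exact: (measurable_absqB q (mQ f) (mQ g)).
have a0 (x : R) : 0 <= (absq q x)%:E by rewrite lee_fin absq_ge0.
rewrite -[X in _ <= X + _](@ge0_integralZl _ _ _ lam setT measurableT _ (mD _ _)) ?lee_fin//.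
rewrite -[X in _ <= _ + X](@ge0_integralZl _ _ _ lam setT measurableT _ (mD _ _)) ?lee_fin//.
rewrite -(@ge0_integralD _ _ _ lam setT measurableT); first last.
- by apply: emeasurable_funM; [exact: measurable_cst|exact: mD].
- by move=> u _; rewrite mule_ge0 ?lee_fin// absq_ge0.
- by apply: emeasurable_funM; [exact: measurable_cst|exact: mD].
- by move=> u _; rewrite mule_ge0 ?lee_fin// absq_ge0.
apply: ge0_le_integral; rewrite ?lee_fin//.
- exact: mD.
- by apply: emeasurable_funD; (apply: emeasurable_funM; [exact: measurable_cst|exact: mD]).
move=> u _; rewrite -!EFinM -EFinD lee_fin.
have := @absq_split _ _ q1 t (unit_quantile (nu s) u - unit_quantile n u)
  (unit_quantile n u - unit_quantile m u) t01.
by rewrite addrA subrK [X in (_ <= _ * X + _)%R -> _]absqC.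
Qed.

Lemma cost_le_unfairness : cost <= unfairness Y.
Proof.
apply: le_ereal_inf_tmp => _ [m _ <-].
apply: (le_trans (costP m)).
apply: lee_sum => s _; apply: lee_wpmul2l; first by rewrite lee_fin.
by rewrite -nuE; exact: quantile_cost_le_Wqq.
Qed.

Let riskC V W : risk V W = risk W V.
Proof.
apply: eq_bigr => s _; congr (_ * _); apply: eq_integral => t _.
by rewrite absqC.
Qed.

Lemma unfairness_cost : unfairness Y = cost.
Proof.
apply/eqP; rewrite eq_le cost_le_unfairness andbT.
by rewrite -risk_repaired riskC unfairness_le_risk.
Qed.

Hypothesis cost_lty : cost < +oo.

Lemma cost_ge0 : 0 <= cost.
Proof.
apply: sume_ge0 => s _; rewrite mule_ge0 ?lee_fin// integral_ge0// => u _.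
by rewrite lee_fin absq_ge0.
Qed.

Lemma risk_ge0 V W : 0 <= risk V W.
Proof.
apply: sume_ge0 => s _; rewrite mule_ge0 ?lee_fin// integral_ge0// => u _.
by rewrite lee_fin absq_ge0.
Qed.

Lemma unfairness_ge0 V : 0 <= unfairness V.
Proof.
apply: le_ereal_inf_tmp => _ [m _ <-]; apply: sume_ge0 => s _.
rewrite mule_ge0 ?lee_fin//; apply: le_ereal_inf_tmp => _ [p _ <-].
by apply: integral_ge0 => z _; rewrite lee_fin absq_ge0.
Qed.

Let costE : cost = (fine cost)%:E.
Proof. by rewrite fineK// ge0_fin_numE// cost_ge0. Qed.

Lemma cost_tradeoff V (t r v : R) : (forall s, measurable_fun [set: T] (V s)) ->
  (0 < t < 1)%R -> risk V Y = r%:E -> unfairness V <= v%:E ->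
  (fine cost <= t `^ (1 - q) * r + (1 - t) `^ (1 - q) * v)%R.
Proof.
move=> mV t01 riskE Uv; have /andP[t0 t1] := t01.
have ct1 : (0 < (1 - t) `^ (1 - q))%R by rewrite powR_gt0// subr_gt0.
set c1 := (t `^ (1 - q))%R; set c2 := ((1 - t) `^ (1 - q))%R.
(* The tradeoff is solved for the transport term: the resulting bound is free of [m] and passes to
   the infimum. *)
have : ((c2^-1 * (fine cost - c1 * r))%R)%:E <= unfairness V.
  apply: le_ereal_inf_tmp => _ [m _ <-].
  have := cost_le_risk_Wqq m mV t01; rewrite riskE -/c1 -/c2 => h.
  by rewrite EFinM lee_pdivrMl// EFinB EFinM -costE leeBlDl.
move=> /le_trans /(_ Uv); rewrite lee_fin ler_pdivrMl// lerBlDl.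
by [].
Qed.

Variable a : R.
Hypothesis a01 : (0 <= a <= 1)%R.
Let a0 : (0 <= a)%R. Proof. by case/andP: a01. Qed.
Let a1 : (0 <= 1 - a)%R. Proof. by rewrite subr_ge0; case/andP: a01. Qed.

Let powR_split (x : R) : (0 < x)%R -> (x `^ q = x / x `^ (1 - q))%R.
Proof.
move=> x0; rewrite -{2}(powRr1 (ltW x0)) -powRB; last by rewrite (gt_eqF x0) implybT.
by rewrite subKr.
Qed.

(** At [t = 1 - a] the tradeoff reads [C <= (1 - a)^(1 - q) r + a C], which rearranges to the claim
    when [0 < a < 1]. *)
Lemma risk_ge_of_unfairness V : (forall s, measurable_fun [set: T] (V s)) ->
  unfairness V <= (a `^ q)%:E * cost -> ((1 - a) `^ q)%:E * cost <= risk V Y.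
Proof.
move=> mV; rewrite costE -!EFinM => Ua.
have c0 : (0 <= fine cost)%R by rewrite fine_ge0// cost_ge0.
have [->|ny] := eqVneq (risk V Y) +oo; first by rewrite leey.
have riskE : risk V Y = (fine (risk V Y))%:E.
  by rewrite fineK// ge0_fin_numE ?risk_ge0// lt_neqAle ny leey.
rewrite riskE lee_fin; set r := fine (risk V Y) in riskE *.
have r0 : (0 <= r)%R by rewrite fine_ge0// risk_ge0.
have trade t (t01 : (0 < t < 1)%R) := cost_tradeoff mV t01 riskE Ua.
move: a0; rewrite le_eqVlt => /orP[/eqP ae0|agt0].
  rewrite -ae0 subr0 powR1 mul1r; rewrite -lee_fin.
  apply/lee_mul01Pr => [|z /andP[z0 z1]]; rewrite ?lee_fin//.
  (* For [a = 0] the value [t = 1] is excluded, so the bound is proved up to each factor [z < 1]: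
     this [t] gives [z C = t^q C <= t r <= r]. *)
  pose t := (z `^ q^-1)%R.
  have t0 : (0 < t)%R by exact: powR_gt0.
  have t1 : (t < 1)%R.
    have <- : (1 `^ q^-1 = 1 :> R)%R by rewrite powR1.
    by rewrite /t gt0_ltr_powR ?nnegrE ?invr_gt0// ltW.
  have tq : (t `^ q = z)%R by rewrite -powRrM mulVf ?gt_eqF// powRr1// ltW.
  have := trade t; rewrite t0 t1 -ae0 powR0 ?gt_eqF// mul0r mulr0 addr0 => /(_ isT) h.
  rewrite -tq.
  apply: (@le_trans _ _ (t * r)%R); last by rewrite ler_piMl// ltW.
  have <- : (t `^ q * (t `^ (1 - q) * r) = t * r)%R.
    rewrite mulrA -powRD; last by rewrite (gt_eqF t0) implybT.
    by rewrite addrC subrK powRr1// ltW.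
  by rewrite ler_wpM2l// powR_ge0.
move: a1; rewrite le_eqVlt => /orP[/eqP ae1|alt1].
  by rewrite -ae1 powR0 ?gt_eqF// mul0r.
have := trade (1 - a)%R.
rewrite alt1 ltrBlDr ltrDl agt0 => /(_ isT).
rewrite subKr mulrA -powRD; last by rewrite (gt_eqF agt0) implybT.
rewrite subrK powRr1// => h.
by rewrite powR_split// mulrAC ler_pdivrMr ?powR_gt0// mulrBl mul1r lerBlDr [(r * _)%R]mulrC.
Qed.

Definition partial_repair (s : 'I_K) (t : T) : R := (a * Y s t + (1 - a) * repaired s t)%R.

Lemma measurable_partial_repair s : measurable_fun [set: T] (partial_repair s).
Proof.
apply: measurable_funD; apply: measurable_funM; try exact: measurable_cst.
  exact: mY.
exact: measurable_repaired.
Qed.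

Let riskZ (V W V' W' : 'I_K -> T -> R) (b : R) : (0 <= b)%R ->
  (forall s, measurable_fun [set: T] (V' s)) -> (forall s, measurable_fun [set: T] (W' s)) ->
  (forall s t, V s t - W s t = b * (V' s t - W' s t))%R ->
  risk V W = (b `^ q)%:E * risk V' W'.
Proof.
move=> b0 mV mW VW; rewrite /risk ge0_sume_distrr; last first.
  by move=> s _; rewrite mule_ge0 ?lee_fin// integral_ge0// => u _; rewrite lee_fin absq_ge0.
apply: eq_bigr => s _; rewrite muleCA; congr (_ * _).
rewrite -ge0_integralZl//.
- by apply: eq_integral => t _; rewrite VW absqM// EFinM.
- exact: measurable_absqB.
- by move=> t _; rewrite lee_fin absq_ge0.
- by rewrite lee_fin powR_ge0.
Qed.

Lemma risk_partial_repair : risk partial_repair Y = ((1 - a) `^ q)%:E * cost.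
Proof.
rewrite -risk_repaired; apply: riskZ => //; first exact: measurable_repaired.
by move=> s t; rewrite /partial_repair; ring.
Qed.

(** The upper bound holds because the distance to [repaired] shrinks by the factor [a]. For
    [0 < a < 1], inserting the known risk in the tradeoff at [t = 1 - a] gives the lower bound; the
    endpoints are direct. *)
Lemma unfairness_partial_repair : unfairness partial_repair = (a `^ q)%:E * cost.
Proof.
have mG := measurable_partial_repair.
have Ule : unfairness partial_repair <= (a `^ q)%:E * cost.
  apply: (le_trans (unfairness_le_risk mG)).
  rewrite -risk_repaired riskC -(riskC Y); rewrite riskC (@riskZ _ _ Y repaired a)//.
    exact: measurable_repaired.
  by move=> s t; rewrite /partial_repair; ring.
apply/eqP; rewrite eq_le Ule/=.
have c0 : (0 <= fine cost)%R by rewrite fine_ge0// cost_ge0.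
have [aE0|aN0] := eqVneq a 0%R.
  by rewrite aE0 powR0 ?gt_eqF// mul0e unfairness_ge0.
have [aE1|aN1] := eqVneq (1 - a)%R 0%R.
  have -> : partial_repair = Y.
    apply/funext => s; apply/funext => t; rewrite /partial_repair aE1 mul0r addr0.
    by rewrite (_ : a = 1%R) ?mul1r//; apply/esym/eqP; rewrite -subr_eq0 aE1.
  rewrite unfairness_cost (_ : a = 1%R) ?powR1 ?mul1e//.
  by apply/esym/eqP; rewrite -subr_eq0 aE1.
have agt0 : (0 < a)%R by rewrite lt_neqAle eq_sym aN0.
have alt1 : (0 < 1 - a)%R by rewrite lt_neqAle eq_sym aN1.
have UE : unfairness partial_repair = (fine (unfairness partial_repair))%:E.
  rewrite fineK// ge0_fin_numE ?unfairness_ge0//; apply: (le_lt_trans Ule).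
  by rewrite costE -EFinM ltry.
have t01 : (0 < 1 - a < 1)%R by rewrite alt1 ltrBlDr ltrDl.
have Ule' : unfairness partial_repair <= (fine (unfairness partial_repair))%:E.
  by rewrite -UE.
have := cost_tradeoff mG t01 _ Ule'.
rewrite risk_partial_repair costE -EFinM => /(_ _ erefl)/=.
rewrite UE lee_fin subKr mulrA -powRD; last by rewrite (gt_eqF alt1) implybT.
rewrite subrK powRr1// => h.
by rewrite powR_split// mulrAC ler_pdivrMr ?powR_gt0// [leRHS]mulrC; lra.
Qed.

End fair_repair.

(** * From features and groups to conditional random variables *)

Section features.
Context {d} {T : measurableType d} {R : realType} (P : probability T R) {p K : nat}.
Variables (X : T -> 'rV[R]_p) (S : T -> 'I_K) (w : 'I_K -> R) (q : R).
Hypothesis mX : measurable_rV X.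
Hypothesis mS : forall s, measurable (evS S s).
Hypothesis PS : forall s, (0 < P (evS S s))%E.

Definition group_prob (s : 'I_K) : probability T R := cond_prob (mS s) (PS s).

(** The group is frozen at [s]; on the event [S = s], the only one that [group_prob s] charges, this
    agrees with [pred_rv]. *)
Definition prediction (f : 'rV[R]_p -> 'I_K -> R) (s : 'I_K) (t : T) : R := f (X t) s.

Lemma measurable_prediction f s : measurable_feat f ->
  measurable_fun [set: T] (prediction f s).
Proof. by move=> mf _ A mA; rewrite setTI; exact: (mX (mf s A mA)). Qed.

Lemma condlawE f s :
  condlaw P S (pred_rv X S f) s = (fun A => group_prob s (prediction f s @^-1` A)).
Proof.
apply/funext => A; rewrite /= cond_probE /condlaw; congr (P _ * _)%E.
by apply/seteqP; split => t [fA ts]; split=> //; move: fA;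
  rewrite /= /pred_rv /prediction (ts : S t = s).
Qed.

Lemma UqE f : Uq P X S w q f = unfairness q w group_prob (prediction f).
Proof.
rewrite /Uq /unfairness; congr ereal_inf; apply: eq_imagel => m _.
by apply: eq_bigr => s _; rewrite condlawE.
Qed.

Lemma RqE g f : measurable_feat g -> measurable_feat f ->
  Rq P X S w q g f = risk q w group_prob (prediction f) (prediction g).
Proof.
move=> mg mf; apply: eq_bigr => s _; congr (_ * _)%E.
rewrite ge0_integral_cond_prob.
- rewrite /condexp; congr (_ * _)%E; apply: eq_integral => t.
  by rewrite inE => /= ts; rewrite /pred_rv /prediction ts.
- by apply: measurable_absqB; exact: measurable_prediction.
- by move=> t; rewrite lee_fin absq_ge0.
Qed.

End features.

Theorem theorem9 (d : measure_display) (Omega : measurableType d) (R : realType)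
  (P : probability Omega R) (p K : nat)
  (X : Omega -> 'rV[R]_p) (S : Omega -> 'I_K)
  (fstar : 'rV[R]_p -> 'I_K -> R) (w : 'I_K -> R) (q alpha : R) :
  measurable_rV X ->
  (forall s, measurable (evS S s)) ->
  (forall s, (0 < P (evS S s))%E) ->
  measurable_feat fstar ->
  (forall s, 0 <= w s) -> \sum_(s < K) w s = 1 ->
  1 <= q ->
  (* nu*_s = Law(f*(X,S) | S = s) is non-atomic ... *)
  (forall s (x : R), condlaw P S (pred_rv X S fstar) s [set x] = 0%E) ->
  (* ... and has a finite q-th moment *)
  (forall s, (\int[condlaw P S (pred_rv X S fstar) s]_y (absq q y)%:E < +oo)%E) ->
  0 <= alpha <= 1 ->
  let nus := condlaw P S (pred_rv X S fstar) in
  let a := alpha `^ (q^-1) in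
  exists m : 'rV[R]_p -> 'I_K -> R,
    (* m x s is a minimizer of y |-> sum_s' w_s' |F^-1_{nu*_s'}(F_{nu*_s}(f*(x,s))) - y|^q *)
    (forall x s (y : R),
       \sum_(s' < K) w s' * absq q (quantile_of (nus s') (cdf_of (nus s) (fstar x s)) - m x s)
       <= \sum_(s' < K) w s' * absq q (quantile_of (nus s') (cdf_of (nus s) (fstar x s)) - y)) /\
    (let g := (fun x s => a * fstar x s + (1 - a) * m x s) in
    (* g solves min { R_q(f) : U_q(f) <= alpha U_q(fstar) } *)
    (measurable_feat g /\
     (Uq P X S w q g <= alpha%:E * Uq P X S w q fstar)%E /\
     (forall f : 'rV[R]_p -> 'I_K -> R, measurable_feat f ->
        (Uq P X S w q f <= alpha%:E * Uq P X S w q fstar)%E ->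
        (Rq P X S w q fstar g <= Rq P X S w q fstar f)%E)) /\
    Rq P X S w q fstar g = (((1 - a) `^ q)%:E * Uq P X S w q fstar)%E /\
    Uq P X S w q g = (alpha%:E * Uq P X S w q fstar)%E).
Proof.
move=> mX mS PS mf w0 w1 q1 atom mom /andP[al0 al1] nus a.
have q0 : 0 < q by exact: lt_le_trans q1.
have aq : a `^ q = alpha by rewrite -powRrM mulVf ?gt_eqF// powRr1.
have a01 : 0 <= a <= 1.
  rewrite powR_ge0/=; have <- : 1 `^ q^-1 = 1 :> R by rewrite powR1.
  by rewrite ge0_ler_powR ?nnegrE// invr_ge0 ltW.
pose Pc := group_prob mS PS; pose Y := prediction X fstar.
have mY s : measurable_fun [set: Omega] (Y s) by exact: measurable_prediction.
(* The conditional laws are bare set functions; they are replaced by bundled probabilities. *)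
have [nu nuE] : exists nu : 'I_K -> probability R R, forall s,
    (nu s : set R -> \bar R) = (fun A => Pc s (Y s @^-1` A)).
  by have [nu nuE] := choice (fun s => law_exists (Pc s) (mY s)); exists nu.
have nusE s : nus s = nu s by rewrite nuE -condlawE.
have atomless s x : nu s [set x] = 0%E.
  by rewrite -[LHS]/((nu s : set R -> \bar R) [set x]) -nusE.
have moment s : finite_moment q (nu s).
  by rewrite /finite_moment -[X in integral X]/(nu s : set R -> \bar R) -nusE.
pose B := unit_barycenter q w nu.
have mB : measurable_fun [set: R] B := measurable_unit_barycenter nu q1 w0 w1.
have momB := barycenter_moment q1 w0 w1 moment.
have costP := barycenter_cost_le nu q1 w0 w1.
have costy := barycenter_cost_lty q1 w0 w1 moment.
(* Minimality must hold at every [x], including ranks 0 and 1: there [least_mean] still minimizes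
   for whatever values [quantile_of] takes. *)
exists (fun x s => B (cdf_of (nu s) (fstar x s))); split.
  move=> x s y; rewrite !nusE.
  have u01 : 0 <= cdf_of (nu s) (fstar x s) <= 1.
    by rewrite cdf_of_ge0 cdf_of_le1.
  rewrite /B (unit_barycenterE _ _ _ u01).
  under eq_bigr do rewrite nusE; under [leRHS]eq_bigr do rewrite nusE.
  exact: (least_meanP q1 w0 w1 (fun s' => quantile_of (nu s') (cdf_of (nu s) (fstar x s))) y).
move=> g.
have mg : measurable_feat g.
  (* Within a group, [g] is a Borel function of [fstar]. *)
  move=> s A mA; apply: (mf s ((fun y => a * y + (1 - a) * B (cdf_of (nu s) y)) @^-1` A)).
  rewrite -[_ @^-1` _]setTI.
  have mBF := measurableT_comp mB (measurable_cdf_of (nu s)).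
  have mh : measurable_fun [set: R] (fun y => a * y + (1 - a) * B (cdf_of (nu s) y)).
    apply: measurable_funD; first exact: measurable_funM.
    by apply: measurable_funM; [exact: measurable_cst|exact: mBF].
  exact: mh.
have gE : prediction X g = partial_repair Y nu B a by [].
have Ug := unfairness_partial_repair q1 w0 mY nuE atomless mB momB costP costy a01.
have Rg : risk q w Pc (partial_repair Y nu B a) Y =
    (((1 - a) `^ q)%:E * barycenter_cost q w nu)%E.
  exact: risk_partial_repair.
have Us := unfairness_cost q1 w0 mY nuE atomless mB momB costP.
rewrite !(UqE X w q mS PS) gE Ug Us aq.
rewrite !(RqE w q mX mS PS)// gE Rg.
split=> //; split=> //; split=> // f mf' Uf.
rewrite (UqE X w q mS PS) in Uf.
rewrite (RqE w q mX mS PS)//.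
apply: (risk_ge_of_unfairness q1 w0 mY nuE costP costy a01) => //.
  by move=> s; exact: measurable_prediction.
by rewrite aq.
Qed.
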